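(* Let $\mathcal{P}_n$ be the set of separated partitions of $[n]$ and $\mathcal{RSP}(n)$ the set of run-sorted permutations of $[n]$. Define $\theta:\mathcal{P}_n\to\mathcal{RSP}(n)$ as follows. For $P=B_1/\cdots/B_k\in\mathcal{P}_n$ in block representation, call an element $b\in B_i$ with $2\le i\le k$ movable if $b\ne\min(B_i)$ and $b-1\in B_j$ for some $j<i$. Form new blocks $C_1,\dots,C_k$ where $C_i$ consists of the non-movable elements of $B_i$ together with the movable elements of $B_{i+1}$ (with $B_{k+1}=\emptyset$), each $C_i$ arranged in increasing order; then $\theta(P)$ is the concatenation $C_1C_2\cdots C_k$. Then $\theta$ is a bijection.
   Context: A set partition of $[n]$ in block representation $B_1/\cdots/B_k$ has blocks ordered by increasing minima. It is separated if no two consecutive integers $b,b+1$ lie in the same block. A permutation of $[n]$ is run-sorted if it is the concatenation of the blocks (each in increasing order) of a set partition of $[n]$ in block representation; equivalently the minima of its successive runs (maximal increasing factors) are increasing. (In the paper, $\theta$ is described as processing $i=2,\dots,k$ in order and moving each movable $b\in B_i$ to block $i-1$, then flattening; this is the same map.) *)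

(* Defs.v *)
From mathcomp Require Import all_boot all_fingroup.
Set Implicit Arguments.
Unset Strict Implicit.
Unset Printing Implicit Defensive.

(* The ground set [n] = {1, ..., n} is encoded as 'I_n: the ordinal i stands
   for the integer i + 1.  Block indices are likewise 0-based: block P i is
   the block B_(i+1) of the block representation. *)

Definition set_partition n (P : {set {set 'I_n}}) : bool :=
  partition P [set: 'I_n].

Definition separated n (P : {set {set 'I_n}}) : bool :=
  [forall B in P, forall a in B, forall b in B, (b : nat) != a.+1].

(* The default value n is only returned on the empty set. *)
Definition block_min n (B : {set 'I_n}) : nat :=
  \big[minn/n]_(b in B) (b : nat).

Definition increasing_word n (B : {set 'I_n}) : seq 'I_n :=
  sort (fun a b : 'I_n => a <= b) (enum B).

Definition block_representation n (P : {set {set 'I_n}}) : seq {set 'I_n} :=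
  sort (fun A B : {set 'I_n} => block_min A <= block_min B) (enum P).

(* Out-of-range indices give the empty set, so B_(k+1) is empty. *)
Definition block n (P : {set {set 'I_n}}) (i : nat) : {set 'I_n} :=
  nth set0 (block_representation P) i.

Definition one_line n (s : 'S_n) : seq 'I_n := [seq s i | i <- enum 'I_n].

Definition run_sorted n (s : 'S_n) : bool :=
  [exists P : {set {set 'I_n}}, set_partition P &&
    (one_line s ==
       flatten [seq increasing_word B | B <- block_representation P])].

Definition movable n (P : {set {set 'I_n}}) (i : nat) (b : 'I_n) : bool :=
  [&& 0 < i, b \in block P i, (b : nat) != block_min (block P i) &
      [exists j : 'I_i, exists a in block P j, a.+1 == (b : nat)]].

Definition new_block n (P : {set {set 'I_n}}) (i : nat) : {set 'I_n} :=
  [set b in block P i | ~~ movable P i b] :|: [set b | movable P i.+1 b].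

Definition theta_word n (P : {set {set 'I_n}}) : seq 'I_n :=
  flatten [seq increasing_word (new_block P i) | i <- iota 0 #|P|].

Definition separated_partitions n : Type :=
  {P : {set {set 'I_n}} | set_partition P && separated P}.

Definition run_sorted_perms n : Type := {s : 'S_n | run_sorted s}.

(* Main.v *)
(** A partition in block representation is the restricted growth function [f]
sending each element to the index of its block. On these functions theta is
local: it lowers [f x] by one or keeps it, depending on [f (x - 1)]. It keeps
the block minima, and separation makes every other element of [C_i] precede in
the word some smaller element: the image is "tight", its block minima being
exactly the right-to-left minima of the word. A tight function is therefore
determined by its word, and [f] is recovered from it by increasing [x].
Conversely, cutting a block at a right-to-left minimum leaves the word
unchanged, so every run-sorted word is the word of a tight function. *)

Require Import Defs.
From mathcomp Require Import all_boot all_order all_fingroup zify.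
Set Implicit Arguments.
Unset Strict Implicit.
Unset Printing Implicit Defensive.

Import Order.TTheory.

(** * First occurrences and restricted growth functions *)

Definition is_first (T : eqType) (f : nat -> T) (x : nat) : bool :=
  [forall y : 'I_x, f y != f x].

Section FirstOccurrence.
Variables (T : eqType) (f : nat -> T).

Lemma is_firstP x : reflect (forall y, y < x -> f y <> f x) (is_first f x).
Proof.
apply: (iffP forallP) => [fx y yx|fx y]; first exact/eqP/(fx (Ordinal yx)).
exact/eqP/fx.
Qed.

Lemma is_firstPn x :
  reflect (exists2 y, y < x & f y = f x) (~~ is_first f x).
Proof.
apply: (iffP forallPn) => [[y /negPn/eqP fyx]|[y yx fyx]]; first by exists y.
by exists (Ordinal yx); rewrite /= fyx eqxx.
Qed.

Lemma first_occurrence x : exists y, [/\ y <= x, is_first f y & f y = f x].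
Proof.
elim/ltn_ind: x => x IH.
have [fx|/is_firstPn[y yx fyx]] := boolP (is_first f x); first by exists x.
have [z [zy fz fzy]] := IH y yx.
by exists z; split; [lia | | rewrite fzy].
Qed.

Lemma is_first_eq x y : is_first f x -> is_first f y -> f x = f y -> x = y.
Proof.
move=> /is_firstP fx /is_firstP fy fxy.
by have [/fy|/fx|] := ltngtP x y; rewrite ?fxy.
Qed.

End FirstOccurrence.

Lemma eq_is_first (T U : eqType) (f : nat -> T) (g : nat -> U) x :
    (forall y, y < x -> (f y == f x) = (g y == g x)) ->
  is_first f x = is_first g x.
Proof. by move=> fg; apply: eq_forallb => y; rewrite fg. Qed.

Definition rgf (n : nat) (f : nat -> nat) : Prop :=
  forall x i, x < n -> i < f x -> exists2 y, y < x & f y = i.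

Section RestrictedGrowth.
Variables (n : nat) (f : nat -> nat).
Hypothesis rgf_f : rgf n f.

Lemma rgf_first x i : x < n -> i < f x ->
  exists y, [/\ y < x, is_first f y & f y = i].
Proof.
move=> xn ix; have [y yx fy] := rgf_f xn ix.
by have [z [zy fz fzy]] := first_occurrence f y; exists z; split=> //; lia.
Qed.

Lemma rgf_lt_first x y : x < n -> is_first f x -> y < x -> f y < f x.
Proof.
move=> xn /is_firstP fx yx; rewrite ltn_neqAle; apply/andP; split.
  exact/eqP/fx.
rewrite leqNgt; apply/negP => fxy.
have [|z zy /fx] := rgf_f _ fxy; first exact: ltn_trans xn.
by apply; apply: ltn_trans yx.
Qed.

End RestrictedGrowth.

Lemma rgf_eq_on_first n f g : rgf n f -> rgf n g ->
    {in gtn n, is_first f =1 is_first g} ->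
  forall x, x < n -> is_first f x -> f x = g x.
Proof.
move=> rgf_f rgf_g fg; elim/ltn_ind => x IH xn fx.
have gx : is_first g x by rewrite -fg.
have [lt|lt|//] := ltngtP (f x) (g x).
  have [y [yx gy gyE]] := rgf_first rgf_g xn lt.
  have yn : y < n by lia.
  by case: (is_firstP _ _ fx y yx); rewrite IH // fg.
have [y [yx fy fyE]] := rgf_first rgf_f xn lt.
by case: (is_firstP _ _ gx y yx); rewrite -IH //; lia.
Qed.

Lemma rgf_eq_kernel n f g : rgf n f -> rgf n g ->
    (forall x y, x < n -> y < n -> (f x == f y) = (g x == g y)) ->
  {in gtn n, f =1 g}.
Proof.
move=> rgf_f rgf_g ker x xn.
have [y [yx fy fyx]] := first_occurrence f x.
have yn : y < n by apply: leq_ltn_trans xn.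
have gyx : g y = g x by apply/eqP; rewrite -ker // fyx.
rewrite -fyx -gyx; apply: (rgf_eq_on_first rgf_f rgf_g) => // z zn.
by apply: eq_is_first => t tz; apply: ker => //; apply: ltn_trans zn.
Qed.

Section Reassignment.
Variables (n : nat) (f g : nat -> nat).
Hypothesis first_kept : forall x, x < n -> is_first f x -> g x = f x.
Hypothesis rest_to_opened :
  forall x, x < n -> ~~ is_first f x -> exists2 y, y < x & f y = g x.

Let opened x : x < n -> exists y, [/\ y <= x, is_first f y & f y = g x].
Proof.
move=> xn; have [fx|/(rest_to_opened xn)[y yx <-]] := boolP (is_first f x).
  by exists x; rewrite first_kept.
by have [z [zy fz fzy]] := first_occurrence f y; exists z; split=> //; lia.
Qed.

Lemma is_first_reassigned x : x < n -> is_first g x = is_first f x.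
Proof.
move=> xn; apply/idP/idP => [gx|fx].
  apply: contraLR gx => nfx; have [y yx fyx] := rest_to_opened xn nfx.
  have [z [zy fz fzy]] := first_occurrence f y.
  apply/is_firstPn; exists z; first exact: leq_ltn_trans yx.
  by rewrite first_kept // ?fzy //; lia.
apply/is_firstP => y yx.
have [|z [zy fz <-]] := @opened y; first exact: ltn_trans xn.
by rewrite first_kept // => /(is_first_eq fz fx); lia.
Qed.

Lemma rgf_reassigned : rgf n f -> rgf n g.
Proof.
move=> rgf_f x i xn; have [y [yx fy <-]] := opened xn => iy.
have [|z [zy fz fzi]] := rgf_first rgf_f _ iy; first exact: leq_ltn_trans xn.
by exists z; [|rewrite first_kept]; lia.
Qed.

End Reassignment.

(** * The map theta on restricted growth functions *)

Definition separated_fun (n : nat) (f : nat -> nat) : Prop :=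
  forall x, x.+1 < n -> f x <> f x.+1.

Definition tight (n : nat) (g : nat -> nat) : Prop :=
  forall x, x < n -> ~~ is_first g x -> exists2 y, y < x & g x < g y.

Definition movable_at (f : nat -> nat) (x : nat) : bool :=
  ~~ is_first f x && (f x.-1 < f x).

Definition theta_fun (f : nat -> nat) (x : nat) : nat := f x - movable_at f x.

Fixpoint theta_inv_fun (g : nat -> nat) (x : nat) : nat :=
  if x is y.+1 then
    g y.+1 + (~~ is_first g y.+1 && (theta_inv_fun g y <= g y.+1))
  else g 0.

Lemma eq_theta_fun n f g :
  {in gtn n, f =1 g} -> {in gtn n, theta_fun f =1 theta_fun g}.
Proof.
move=> fg x xn; have fg' y : y <= x -> f y = g y.
  by move=> yx; apply: fg; apply: leq_ltn_trans xn.
have first_fg : is_first f x = is_first g x.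
  by apply: eq_is_first => y yx; rewrite !fg' // ltnW.
by rewrite /theta_fun /movable_at first_fg !fg' ?leq_pred.
Qed.

Lemma eq_theta_inv_fun n f g :
  {in gtn n, f =1 g} -> {in gtn n, theta_inv_fun f =1 theta_inv_fun g}.
Proof.
move=> fg; elim=> [|x IH] xn /=; first exact: fg.
rewrite IH ?fg //; last exact: ltnW.
rewrite (@eq_is_first _ _ f g) // => y yx.
by rewrite !fg //; apply: ltn_trans xn.
Qed.

Section ThetaFun.
Variables (n : nat) (f : nat -> nat).
Hypothesis rgf_f : rgf n f.

Lemma theta_fun_le x : theta_fun f x <= f x.
Proof. exact: leq_subr. Qed.

Lemma theta_fun_first x : is_first f x -> theta_fun f x = f x.
Proof. by rewrite /theta_fun /movable_at => ->; apply: subn0. Qed.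

Let theta_fun_opened x : x < n -> ~~ is_first f x ->
  exists2 y, y < x & f y = theta_fun f x.
Proof.
rewrite /theta_fun /movable_at => xn nfx; rewrite nfx /=.
case: ltnP => lt; last by rewrite subn0; apply/is_firstPn.
by apply: rgf_f => //; lia.
Qed.

Lemma is_first_theta_fun x : x < n -> is_first (theta_fun f) x = is_first f x.
Proof.
apply: is_first_reassigned => [y _|]; first exact: theta_fun_first.
exact: theta_fun_opened.
Qed.

Lemma rgf_theta_fun : rgf n (theta_fun f).
Proof.
apply: rgf_reassigned rgf_f => [x _|]; first exact: theta_fun_first.
exact: theta_fun_opened.
Qed.

Hypothesis sep_f : separated_fun n f.

Let pred_separated x : x < n -> ~~ is_first f x -> 0 < x /\ f x.-1 <> f x.
Proof.
move=> xn /is_firstPn[y yx _]; have x0 : 0 < x by apply: leq_trans yx.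
by split=> //; rewrite -{2}(prednK x0); apply: sep_f; rewrite prednK.
Qed.

Lemma tight_theta_fun : tight n (theta_fun f).
Proof.
move=> x xn; rewrite is_first_theta_fun // => nfx.
have [x0 sep_x] := pred_separated xn nfx.
suff [y yx fxy] : exists2 y, y < x & theta_fun f x < f y.
  have [z [zy fz fzy]] := first_occurrence f y.
  by exists z; [lia | rewrite (theta_fun_first fz) fzy].
rewrite /theta_fun /movable_at nfx /=; case: ltnP => lt.
  by have /is_firstPn[y yx fyx] := nfx; exists y => //; lia.
by exists x.-1; lia.
Qed.

Lemma theta_funK : {in gtn n, theta_inv_fun (theta_fun f) =1 f}.
Proof.
elim=> [|x IH] xn; first by rewrite /= theta_fun_first //; apply/is_firstP.
rewrite /= IH ?is_first_theta_fun //; last exact: ltnW.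
have := sep_f xn; rewrite /theta_fun /movable_at /=.
by case: (is_first f x.+1) => /=; lia.
Qed.

End ThetaFun.

Section ThetaInvFun.
Variables (n : nat) (g : nat -> nat).
Hypotheses (rgf_g : rgf n g) (tight_g : tight n g).

Let theta_inv_fun_first x : is_first g x -> theta_inv_fun g x = g x.
Proof. by case: x => //= x ->; rewrite addn0. Qed.

Let theta_inv_fun_opened x : x < n -> ~~ is_first g x ->
  exists2 y, y < x & g y = theta_inv_fun g x.
Proof.
case: x => [|x] xn ngx; first by case/is_firstPn: ngx.
rewrite /= ngx /=; case: leqP => _; last by rewrite addn0; apply/is_firstPn.
have [y yx] := tight_g xn ngx; rewrite leq_eqVlt addn1 => /predU1P[->|lt].
  by exists y.
have [|z zy gz] := rgf_g _ lt; first exact: ltn_trans xn.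
by exists z => //; apply: ltn_trans yx.
Qed.

Let is_first_theta_inv_fun x : x < n ->
  is_first (theta_inv_fun g) x = is_first g x.
Proof.
apply: is_first_reassigned => [y _|]; first exact: theta_inv_fun_first.
exact: theta_inv_fun_opened.
Qed.

Lemma rgf_theta_inv_fun : rgf n (theta_inv_fun g).
Proof.
apply: rgf_reassigned rgf_g => [x _|]; first exact: theta_inv_fun_first.
exact: theta_inv_fun_opened.
Qed.

Lemma separated_theta_inv_fun : separated_fun n (theta_inv_fun g).
Proof.
move=> x xn; have [gx|ngx] := boolP (is_first g x.+1).
  have /rgf_lt_first lt := rgf_theta_inv_fun.
  by have := lt x.+1 x xn; rewrite is_first_theta_inv_fun //; lia.
by rewrite /= ngx /=; lia.
Qed.

Lemma theta_inv_funK : {in gtn n, theta_fun (theta_inv_fun g) =1 g}.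
Proof.
move=> x xn; rewrite /theta_fun /movable_at is_first_theta_inv_fun //.
have [gx|ngx] := boolP (is_first g x).
  by rewrite subn0 theta_inv_fun_first.
case: x xn ngx => [|x] xn ngx; first by case/is_firstPn: ngx.
by rewrite /= ngx /=; lia.
Qed.

End ThetaInvFun.

(** * The order of appearance in the word *)

Definition precedes (f : nat -> nat) (x y : nat) : bool :=
  (f x < f y) || ((f x == f y) && (x < y)).

Lemma precedes_trans f : transitive (precedes f).
Proof. by move=> y x z; rewrite /precedes; lia. Qed.

Lemma precedes_irr f : irreflexive (precedes f).
Proof. by move=> x; rewrite /precedes; lia. Qed.

(* The right-hand side says that [x] is a right-to-left minimum of the word. *)
Lemma tight_firstP n g x : rgf n g -> tight n g -> x < n ->
  reflect (forall y, y < x -> precedes g y x) (is_first g x).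
Proof.
move=> rgf_g tight_g xn; apply: (iffP idP) => [gx y yx|rl_min].
  by rewrite /precedes (rgf_lt_first rgf_g).
apply: contraT => /(tight_g x xn)[y yx gxy].
by have := rl_min y yx; rewrite /precedes; lia.
Qed.

Lemma tight_precedes_le n f g : rgf n f -> rgf n g -> tight n f -> tight n g ->
    {in gtn n &, precedes f =2 precedes g} ->
  forall x, x < n -> f x <= g x.
Proof.
move=> rgf_f rgf_g tight_f tight_g fg x xn.
have eq_first z : z < n -> is_first f z = is_first g z.
  move=> zn; have fgz y : y < z -> precedes f y z = precedes g y z.
    by move=> yz; apply: fg => //; apply: ltn_trans zn.
  apply/(tight_firstP rgf_f tight_f zn)/(tight_firstP rgf_g tight_g zn).
    by move=> rl_min y yz; rewrite -fgz ?rl_min.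
  by move=> rl_min y yz; rewrite fgz ?rl_min.
have [z [zx fz fzx]] := first_occurrence f x.
have zn : z < n by apply: leq_ltn_trans xn.
have fgz := rgf_eq_on_first rgf_f rgf_g eq_first zn fz.
have [<-|zx'] := eqVneq z x; first by rewrite fgz.
by have := fg z x zn xn; rewrite /precedes; lia.
Qed.

Lemma tight_precedes_inj n f g : rgf n f -> rgf n g -> tight n f -> tight n g ->
    {in gtn n &, precedes f =2 precedes g} ->
  {in gtn n, f =1 g}.
Proof.
move=> rgf_f rgf_g tight_f tight_g fg x xn; apply/eqP; rewrite eqn_leq.
rewrite (@tight_precedes_le n f g) // (@tight_precedes_le n g f) //.
by move=> y z yn zn; rewrite fg.
Qed.

(* Cuts the block of [x] just before [x], if no [y < x] has [f x < f y]. *)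
Definition split_block (f : nat -> nat) (x y : nat) : nat :=
  f y + ((x <= y) && (f x <= f y)).

Lemma split_block_below f x y : y < x -> split_block f x y = f y.
Proof. by move=> yx; rewrite /split_block leqNgt yx addn0. Qed.

Section SplitBlock.
Variables (n : nat) (f : nat -> nat) (x : nat).
Hypothesis f_max : forall y, y < x -> f y <= f x.

Lemma precedes_split_block : precedes (split_block f x) =2 precedes f.
Proof.
move=> y z; rewrite /precedes /split_block.
by have := @f_max y; have := @f_max z; lia.
Qed.

Lemma is_first_split_block : is_first (split_block f x) x.
Proof.
apply/is_firstP => y yx; rewrite split_block_below // /split_block !leqnn.
by have := f_max yx; lia.
Qed.

Lemma rgf_split_block :
  rgf n f -> ~~ is_first f x -> rgf n (split_block f x).
Proof.
move=> rgf_f /is_firstPn[x' x'x fx'x] y i yn.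
have f_attains j : j < f y -> exists2 z, z < y & f z = j by apply: rgf_f.
rewrite {1}/split_block; have [/andP[xy fxy]|unshifted] := boolP (_ && _).
  rewrite addn1 ltnS => iy; have [ix|xi|->] := ltngtP i (f x).
  - have [|z zy fz] := f_attains i; first exact: leq_trans fxy.
    by exists z; rewrite // /split_block fz; lia.
  - have [ixS|ixS] := eqVneq i (f x).+1.
      exists x; last by rewrite /split_block !leqnn addn1.
      rewrite ltn_neqAle xy andbT.
      by apply: contraTneq xi => ->; rewrite -leqNgt.
    have [|z zy fz] := f_attains i.-1; first by lia.
    by exists z; rewrite // /split_block fz; have := @f_max z; lia.
  - by exists x'; [apply: leq_trans xy | rewrite split_block_below].
rewrite addn0 => iy; have [z zy fz] := f_attains i iy.
by exists z; rewrite // /split_block fz; lia.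
Qed.

End SplitBlock.

Lemma tight_refinement n h m : rgf n h -> m <= n ->
  exists g, [/\ rgf n g, tight m g & precedes g =2 precedes h].
Proof.
move=> rgf_h; elim: m => [|m IH] mn; first by exists h.
have [g [rgf_g tight_g gh]] := IH (ltnW mn).
have [tight_m|] :=
  boolP (is_first g m || [exists y : 'I_m, g m < g y]).
  exists g; split=> // x.
  rewrite ltnS leq_eqVlt => /predU1P[->|]; last exact: tight_g.
  by case/orP: tight_m => [-> //|/existsP[y gmy] _]; exists y.
rewrite negb_or negb_exists => /andP[ngm /forallP max_m].
have g_max y : y < m -> g y <= g m.
  by move=> ym; rewrite leqNgt; apply: (max_m (Ordinal ym)).
exists (split_block g m); split=> [||x y].
- exact: rgf_split_block.
- move=> x; rewrite ltnS leq_eqVlt => /predU1P[->|xm].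
    by rewrite is_first_split_block.
  rewrite (@eq_is_first _ _ _ g) => [/(tight_g x xm)[y yx gxy]|y yx].
    by exists y; rewrite ?split_block_below //; apply: ltn_trans xm.
  by rewrite !split_block_below //; apply: ltn_trans xm.
- by rewrite precedes_split_block.
Qed.

(** * Words *)

(* The sort is stable, so every block is listed in increasing order. *)
Definition word n (f : nat -> nat) : seq 'I_n :=
  sort (fun x y : 'I_n => f x <= f y) (enum 'I_n).

Definition level n (f : nat -> nat) (i : nat) : {set 'I_n} :=
  [set x : 'I_n | f x == i].

Section Word.
Variable n : nat.
Implicit Types (f g : nat -> nat) (x y : 'I_n).

Definition precedes_ord f : rel 'I_n := relpre val (precedes f).

Lemma precedes_ord_trans f : transitive (precedes_ord f).
Proof. by move=> y x z; apply: precedes_trans. Qed.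

Lemma precedes_ord_irr f : irreflexive (precedes_ord f).
Proof. by move=> x; apply: precedes_irr. Qed.

Lemma mem_word f x : x \in word n f.
Proof. by rewrite mem_sort mem_enum. Qed.

Lemma word_sorted f : sorted (precedes_ord f) (word n f).
Proof.
have enum_incr : pairwise (fun x y => x < y) (enum 'I_n).
  rewrite -(pairwise_map val ltn) val_enum_ord.
  by rewrite -sorted_pairwise ?iota_ltn_sorted //; apply: ltn_trans.
have tot : total (fun x y => f x <= f y) by move=> x y; apply: leq_total.
apply: sub_sorted (sort_pairwise_stable tot enum_incr) => x y /=.
by rewrite /precedes_ord /= /precedes; lia.
Qed.

Lemma sorted_word f (w : seq 'I_n) :
  sorted (precedes_ord f) w -> w =i 'I_n -> w = word n f.
Proof.
move=> w_sorted w_full.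
apply: (irr_sorted_eq (@precedes_ord_trans f) (@precedes_ord_irr f)) => //.
  exact: word_sorted.
by move=> x; rewrite mem_word w_full.
Qed.

Lemma precedes_index f x y :
  precedes f x y = (index x (word n f) < index y (word n f)).
Proof.
have index_precedes u v :
    index u (word n f) < index v (word n f) -> precedes f u v.
  have index_lt_precedes := sorted_ltn_index (@precedes_ord_trans f).
  by apply: index_lt_precedes (word_sorted f) _ _ _ _; apply: mem_word.
apply/idP/idP => [xy|]; last exact: index_precedes.
have [//|/index_precedes yx|/(index_inj x (mem_word f x) (mem_word f y))xyE] :=
  ltngtP (index x (word n f)) (index y (word n f)).
  by have := precedes_trans xy yx; rewrite precedes_irr.
by move: xy; rewrite xyE precedes_irr.
Qed.

Lemma eq_word f g :
  word n f = word n g <-> {in gtn n &, precedes f =2 precedes g}.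
Proof.
split=> [fg x y xn yn|fg].
  by rewrite (precedes_index f (Ordinal xn) (Ordinal yn)) fg -precedes_index.
apply: sorted_word; last by move=> x; rewrite mem_word.
have fg_ord : precedes_ord f =2 precedes_ord g.
  by move=> x y; apply: fg; apply: ltn_ord.
by rewrite -(eq_sorted fg_ord) word_sorted.
Qed.

Lemma mem_increasing_word (B : {set 'I_n}) : increasing_word B =i B.
Proof. by move=> x; rewrite mem_sort mem_enum. Qed.

Lemma increasing_word_pairwise (B : {set 'I_n}) :
  pairwise (fun x y => x < y) (increasing_word B).
Proof.
rewrite -(pairwise_map val ltn) -sorted_pairwise; last exact: ltn_trans.
rewrite ltn_sorted_uniq_leq (map_inj_uniq val_inj) sort_uniq enum_uniq /=.
by rewrite sorted_map; apply: sort_sorted => x y; apply: leq_total.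
Qed.

Lemma flatten_levels f k : (forall x : 'I_n, f x < k) ->
  flatten [seq increasing_word (level n f i) | i <- iota 0 k] = word n f.
Proof.
move=> fk; apply: sorted_word => [|x]; last first.
  apply/flatten_mapP; exists (f x); first by rewrite mem_iota fk.
  by rewrite mem_increasing_word inE.
rewrite sorted_pairwise; last exact: precedes_ord_trans.
elim: k {fk} => // k IH.
rewrite -addn1 iotaD map_cat flatten_cat /= cats0 pairwise_cat IH /=.
apply/andP; split.
  apply/allrelP => x y /flatten_mapP[i]; rewrite mem_iota !mem_increasing_word.
  by rewrite !inE /precedes_ord /= /precedes => ik /eqP-> /eqP->; rewrite ik.
apply: (sub_in_pairwise (P := mem (level n f k))) (increasing_word_pairwise _).
  by move=> x y; rewrite !inE /precedes_ord /= /precedes => /eqP-> /eqP->; lia.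
by apply/allP => x; rewrite mem_increasing_word.
Qed.

End Word.

Lemma one_line_inj n : injective (@one_line n).
Proof.
by move=> s t /eq_in_map st; apply/permP => i; apply: st; rewrite mem_enum.
Qed.

Lemma one_lineP n (w : seq 'I_n) :
  reflect (exists s, one_line s = w) (perm_eq w (enum 'I_n)).
Proof.
apply: (iffP (tuple_permP (t := ord_tuple n))) => -[s sw]; exists s.
  by rewrite sw; apply: eq_map => i; rewrite tnth_ord_tuple.
by rewrite -sw; apply: eq_map => i; rewrite tnth_ord_tuple.
Qed.

(** * The block index of a partition *)

Lemma block_min_le n (B : {set 'I_n}) (b : 'I_n) : b \in B -> block_min B <= b.
Proof.
move=> bB; rewrite /block_min -minEnat -leEnat.
exact: bigmin_le_cond (@nat_of_ord n) bB.
Qed.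

Lemma block_min_attained n (B : {set 'I_n}) :
  B != set0 -> exists2 m : 'I_n, m \in B & block_min B = m.
Proof.
case/set0Pn=> b bB; rewrite /block_min -minEnat.
rewrite (bigmin_eq_arg _ b) // => [|x _]; last by rewrite leEnat ltnW.
by case: arg_minP => // m mB _; exists m.
Qed.

(* For [x >= n] the value is the number of blocks. *)
Definition block_index n (P : {set {set 'I_n}}) (x : nat) : nat :=
  find (fun B : {set 'I_n} => [exists y in B, val y == x])
       (block_representation P).

Section BlockIndex.
Variables (n : nat) (P : {set {set 'I_n}}).
Hypothesis partP : set_partition P.

Let size_rep : size (block_representation P) = #|P|.
Proof. by rewrite size_sort cardE. Qed.

Let block_in i : i < #|P| -> block P i \in P.
Proof. by rewrite -size_rep => /(mem_nth set0); rewrite mem_sort mem_enum. Qed.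

Let block_index_bound_mem (x : 'I_n) :
  block_index P x < #|P| /\ x \in block P (block_index P x).
Proof.
have x_cover : x \in cover P by rewrite (cover_partition partP) inE.
have x_block : has (fun B : {set 'I_n} => [exists y in B, val y == x])
                   (block_representation P).
  apply/hasP; exists (pblock P x).
    by rewrite mem_sort mem_enum pblock_mem.
  by apply/existsP; exists x; rewrite mem_pblock x_cover eqxx.
split; first by rewrite -size_rep -has_find.
have /existsP[y /andP[yB /eqP/val_inj yx]] := nth_find set0 x_block.
by rewrite -{1}yx.
Qed.

Lemma block_index_lt (x : 'I_n) : block_index P x < #|P|.
Proof. by have [] := block_index_bound_mem x. Qed.

Let pblock_block_index (x : 'I_n) : pblock P x = block P (block_index P x).
Proof.
have [x_lt x_in] := block_index_bound_mem x; case/and3P: partP => _ triv _.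
exact: def_pblock triv (block_in x_lt) x_in.
Qed.

Lemma mem_block (x : 'I_n) i : (x \in block P i) = (block_index P x == i).
Proof.
have [x_lt x_in] := block_index_bound_mem x; apply/idP/eqP => [xi|<-//].
have iP : i < #|P|.
  rewrite ltnNge -size_rep; apply: contraL xi => le.
  by rewrite /block nth_default ?inE.
case/and3P: partP => _ triv _; have := def_pblock triv (block_in iP) xi.
rewrite pblock_block_index => /eqP; rewrite nth_uniq ?size_rep // => [/eqP //|].
by rewrite sort_uniq enum_uniq.
Qed.

Lemma block_level i : block P i = level n (block_index P) i.
Proof. by apply/setP => x; rewrite mem_block inE. Qed.

Lemma mem_pblock_index (x y : 'I_n) :
  (y \in pblock P x) = (block_index P x == block_index P y).
Proof. by rewrite pblock_block_index mem_block eq_sym. Qed.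

Lemma preim_partition_block_index :
  preim_partition (fun x : 'I_n => block_index P x) [set: 'I_n] = P.
Proof.
rewrite -[RHS](equivalence_partition_pblock partP).
apply: eq_imset => x; apply/setP => y.
by rewrite !inE mem_pblock_index.
Qed.

Lemma block_index_attained i : i < #|P| -> exists2 m : 'I_n,
  block_index P m = i & block_min (block P i) = m.
Proof.
move=> iP; have : block P i != set0.
  by apply: contraTneq (block_in iP) => ->; case/and3P: partP.
case/block_min_attained => m mB minE; exists m => //.
by apply/eqP; rewrite -mem_block.
Qed.

Lemma block_min_mono i j : i <= j -> j < #|P| ->
  block_min (block P i) <= block_min (block P j).
Proof.
rewrite -size_rep => ij jk.
have tr : transitive (fun A B : {set 'I_n} => block_min A <= block_min B).
  by move=> ? ? ?; apply: leq_trans.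
apply: (sorted_leq_nth tr) => //.
- by apply: sort_sorted => A B; apply: leq_total.
- by rewrite inE; apply: leq_ltn_trans jk.
Qed.

Lemma is_first_block_index (x : 'I_n) :
  is_first (block_index P) x = (val x == block_min (block P (block_index P x))).
Proof.
have [m mx minE] := block_index_attained (block_index_lt x).
have mlex : m <= x by rewrite -minE block_min_le // mem_block.
rewrite minE; apply/is_firstP/eqP => [fx|-> y ym yx].
  by case: ltngtP mlex => // /fx.
have yn : y < n by apply: ltn_trans ym _.
have : block_min (block P (block_index P x)) <= Ordinal yn.
  by apply: block_min_le; rewrite mem_block /= yx mx.
by rewrite minE leqNgt ym.
Qed.

Lemma rgf_block_index : rgf n (block_index P).
Proof.
move=> x i xn ix; have xP := block_index_lt (Ordinal xn).
have [|m mi minE] := @block_index_attained i; first exact: ltn_trans xP.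
exists m => //.
have : block_min (block P (block_index P x)) <= Ordinal xn.
  by rewrite block_min_le // mem_block.
have := block_min_mono (ltnW ix) xP; rewrite minE => le1 /(leq_trans le1) mx.
by rewrite ltn_neqAle mx andbT; apply: contraTneq ix => <-; rewrite mi ltnn.
Qed.

Lemma separatedP : reflect (separated_fun n (block_index P)) (separated P).
Proof.
apply: (iffP idP) => [sepP x xn xxS|sepf].
  pose y := Ordinal xn; pose x' := Ordinal (ltnW xn).
  have x'P := block_in (block_index_lt x').
  move/forall_inP/(_ _ x'P)/forall_inP/(_ x'): sepP; rewrite mem_block.
  move/(_ (eqxx _))/forall_inP/(_ y); rewrite mem_block /= -xxS !eqxx.
  by move/(_ isT).
apply/forall_inP => B BP; apply/forall_inP => a aB; apply/forall_inP => b bB.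
apply/eqP => ba; apply: (sepf a); rewrite -ba //.
case/and3P: partP => _ triv _; apply/eqP.
by rewrite -mem_pblock_index (def_pblock triv BP aB).
Qed.

Lemma movableE i (b : 'I_n) :
  movable P i b = (block_index P b == i) && movable_at (block_index P) b.
Proof.
rewrite /movable /movable_at mem_block is_first_block_index.
have [bi|_] := eqVneq (block_index P b) i; last by rewrite andbF.
rewrite bi /=; have [_|nmin] := eqVneq; rewrite /= ?andbF //.
have b0 : 0 < b.
  have := is_first_block_index b; rewrite bi (negbTE nmin).
  case/negbT/is_firstPn=> y yb _.
  exact: leq_ltn_trans yb.
have bn : b.-1 < n by rewrite prednK // ltnW.
apply/andP/idP => [[_ /existsP[j /existsP[a /andP[aj /eqP ab]]]]|lt].
  by move: aj; rewrite mem_block -ab => /eqP->; apply: ltn_ord.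
split; first exact: leq_ltn_trans lt.
apply/existsP; exists (Ordinal lt); apply/existsP; exists (Ordinal bn).
by rewrite mem_block /= prednK // !eqxx.
Qed.

Lemma new_block_level i : new_block P i = level n (theta_fun (block_index P)) i.
Proof.
apply/setP => b; rewrite !inE mem_block !movableE /theta_fun /movable_at.
case: (is_first _ b); rewrite /= ?subn0 ?andbF ?andbT ?orbF //.
by case: ltnP => lt; lia.
Qed.

Lemma theta_wordE : theta_word P = word n (theta_fun (block_index P)).
Proof.
rewrite -(flatten_levels (k := #|P|)) => [|x].
  by congr flatten; apply: eq_map => i; rewrite new_block_level.
exact: leq_ltn_trans (theta_fun_le _ _) (block_index_lt x).
Qed.

Lemma flatten_block_representation :
  flatten [seq increasing_word B | B <- block_representation P] =
  word n (block_index P).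
Proof.
rewrite -(flatten_levels block_index_lt) -size_rep.
rewrite -[block_representation P in LHS](mkseq_nth set0) -map_comp.
by congr flatten; apply: eq_map => i; rewrite /= -block_level.
Qed.

End BlockIndex.

Lemma block_index_inj n (P Q : {set {set 'I_n}}) :
    set_partition P -> set_partition Q ->
  {in gtn n, block_index P =1 block_index Q} -> P = Q.
Proof.
move=> partP partQ PQ.
rewrite -(preim_partition_block_index partP).
rewrite -(preim_partition_block_index partQ).
by apply: eq_imset => x; apply/setP => y; rewrite !inE !PQ //; apply: ltn_ord.
Qed.

Lemma rgf_partition n f : rgf n f ->
  exists2 P : {set {set 'I_n}},
    set_partition P & {in gtn n, block_index P =1 f}.
Proof.
move=> rgf_f; pose P := preim_partition (fun x : 'I_n => f x) [set: 'I_n].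
have partP : set_partition P by apply: preim_partitionP.
exists P => //; apply: rgf_eq_kernel => //; first exact: rgf_block_index.
move=> x y xn yn; rewrite -(mem_pblock_index partP (Ordinal xn) (Ordinal yn)).
rewrite pblock_equivalence_partition ?inE // => a b d _ _ _.
by split=> //= /eqP->.
Qed.

(** * Bijectivity of theta *)

Lemma run_sortedP n (s : 'S_n) :
  reflect (exists2 f, rgf n f & one_line s = word n f) (run_sorted s).
Proof.
apply: (iffP existsP) => [[P /andP[partP /eqP->]]|[f rgf_f ->]].
  exists (block_index P); first exact: rgf_block_index.
  exact: flatten_block_representation.
have [P partP Pf] := rgf_partition rgf_f; exists P; rewrite partP /=.
rewrite flatten_block_representation //; apply/eqP/eq_word => x y xn yn.
by rewrite /precedes !Pf.
Qed.

Lemma theta_word_run_sorted n (P : {set {set 'I_n}}) : set_partition P ->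
  exists2 s : 'S_n, run_sorted s & one_line s = theta_word P.
Proof.
move=> partP; rewrite theta_wordE //; set f := theta_fun _.
have /one_lineP[s sE] : perm_eq (word n f) (enum 'I_n) by rewrite perm_sort.
exists s => //; apply/run_sortedP; exists f => //.
exact/rgf_theta_fun/rgf_block_index.
Qed.

Lemma theta_word_inj n (P Q : {set {set 'I_n}}) :
    set_partition P -> set_partition Q -> separated P -> separated Q ->
  theta_word P = theta_word Q -> P = Q.
Proof.
move=> partP partQ /(separatedP partP) sepP /(separatedP partQ) sepQ.
have rgfP := rgf_block_index partP; have rgfQ := rgf_block_index partQ.
rewrite !theta_wordE // => /eq_word/tight_precedes_inj thetaPQ.
apply: block_index_inj => // x xn.
rewrite -(theta_funK rgfP) // -(theta_funK rgfQ) //.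
apply: (@eq_theta_inv_fun n) => //.
by apply: thetaPQ; do ?exact: rgf_theta_fun; apply: tight_theta_fun.
Qed.

Lemma theta_word_surj n (s : 'S_n) : run_sorted s ->
  exists P : {set {set 'I_n}},
    [/\ set_partition P, separated P & theta_word P = one_line s].
Proof.
case/run_sortedP=> h rgf_h ->.
have [g [rgf_g tight_g gh]] := tight_refinement rgf_h (leqnn n).
have [P partP Pg] := rgf_partition (rgf_theta_inv_fun rgf_g tight_g).
exists P; split=> //.
  apply/(separatedP partP) => x xn; rewrite !Pg //; last exact: ltnW.
  exact: separated_theta_inv_fun xn.
rewrite theta_wordE //; apply/eq_word => x y xn yn.
by rewrite -gh /precedes !(eq_theta_fun Pg) // !(theta_inv_funK rgf_g).
Qed.

Theorem theorem35 (n : nat) :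
  exists theta : separated_partitions n -> run_sorted_perms n,
    (forall P : separated_partitions n,
        one_line (sval (theta P)) = theta_word (sval P)) /\
    bijective theta.
Proof.
have image (P : {P : {set {set 'I_n}} | set_partition P && separated P}) :
    exists t : run_sorted_perms n, one_line (sval t) = theta_word (sval P).
  case: P => P /= /andP[/theta_word_run_sorted[s rs_s sE] _].
  by exists (exist _ s rs_s).
have [theta thetaE] := fin_all_exists image.
have surj (t : {s : 'S_n | run_sorted s}) :
    exists P : separated_partitions n, theta P = t.
  have [P [partP sepP PE]] := theta_word_surj (svalP t).
  have PP : set_partition P && separated P by rewrite partP.
  exists (exist _ P PP); apply: val_inj; apply: one_line_inj.
  exact: etrans (thetaE (exist _ P PP)) PE.
have inj : injective theta.
  move=> P Q PQ; apply: val_inj.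
  case/andP: (svalP P) (svalP Q) => partP sepP /andP[partQ sepQ].
  by apply: theta_word_inj => //; rewrite -!thetaE PQ.
have [eta etaK] := fin_all_exists surj.
by exists theta; split=> //; exists eta => // P; apply: inj; rewrite etaK.
Qed.
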